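(* Let $A\in\mathrm{ASM}(n)$ and $i\in[n-1]$. Let $m$ be the array obtained from $m_A$ as follows: in every row of $m_A$ in which $i+1$ appears and $i$ does not appear, replace $i+1$ with $i$. Then $m=m_{\pi_i^C(A)}$.
   Context: $[n]=\{1,\dots,n\}$. An $n\times n$ alternating sign matrix (ASM) is a matrix $A=(A_{i,j})$ with entries in $\{-1,0,1\}$ such that $\sum_{j=1}^m A_{i,j}\in\{0,1\}$ for all $i,m\in[n]$, $\sum_{i=1}^m A_{i,j}\in\{0,1\}$ for all $j,m\in[n]$, and the sum of all entries is $n$; $\mathrm{ASM}(n)$ is the set of these. The corner sum function of $A$ is $\mathrm{rk}_A(i,j)=\sum_{a\in[i],\,b\in[j]}A_{a,b}$. Strong order on $\mathrm{ASM}(n)$: $A\le B$ iff $\mathrm{rk}_A(i,j)\ge \mathrm{rk}_B(i,j)$ for all $i,j\in[n]$. For $i\in[n-1]$, $\pi_i(A)$ is the minimum, in strong order, of $\{B\in\mathrm{ASM}(n): \mathrm{rk}_B(a,b)=\mathrm{rk}_A(a,b)\text{ for all }a,b\in[n]\text{ with }a\ne i\}$ (this minimum is known to exist). The column version is $\pi_i^C(A)=\pi_i(A^T)^T$. For $A\in\mathrm{ASM}(n)$, let $\widetilde A$ be the matrix whose $i$th row is the sum of the first $i$ rows of $A$; it has entries in $\{0,1\}$ with exactly $i$ ones in row $i$. The monotone triangle $m_A=(m_A(i,j))_{1\le j\le i\le n}$ has as its $i$th row $m_A(i,1)<\dots<m_A(i,i)$ the increasing list of column indices of the ones in row $i$ of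 $\widetilde A$. *)

(* Defs.v *)
From mathcomp Require Import all_boot all_order all_algebra.
From mathcomp Require Import boolp classical_sets.

Set Implicit Arguments.
Unset Strict Implicit.
Unset Printing Implicit Defensive.

Import Order.TTheory GRing.Theory Num.Theory.
Local Open Scope ring_scope.

(* Rows and columns of a matrix are indexed by 'I_n = {0, ..., n-1}, so that   *)
(* k : 'I_n stands for k.+1 in [n].  In particular the index set {1, ..., m},  *)
(* with m in [n] encoded by m : 'I_n, is the set of k : 'I_n with k <= m.      *)

Definition is_asm n (A : 'M[int]_n) : Prop :=
  [/\ forall i j : 'I_n, A i j \in [:: -1; 0; 1],
      forall i m : 'I_n, \sum_(j < n | (j <= m)%N) A i j \in [:: 0; 1],
      forall j m : 'I_n, \sum_(i < n | (i <= m)%N) A i j \in [:: 0; 1] &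
      \sum_(i < n) \sum_(j < n) A i j = n%:Z].

Definition corner_sum n (A : 'M[int]_n) (i j : 'I_n) : int :=
  \sum_(a < n | (a <= i)%N) \sum_(b < n | (b <= j)%N) A a b.

Definition strong_le n (A B : 'M[int]_n) : Prop :=
  forall i j : 'I_n, corner_sum B i j <= corner_sum A i j.

(* Here i is the 1-based number of the row of corner sums left free. *)
Definition row_class n (i : nat) (A : 'M[int]_n) : set 'M[int]_n :=
  [set B | is_asm B /\
           forall a b : 'I_n, a.+1 != i -> corner_sum B a b = corner_sum A a b].

Definition is_strong_min n (S : set 'M[int]_n) (B : 'M[int]_n) : Prop :=
  S B /\ forall B', S B' -> strong_le B B'.

(* The minimum is unique since the corner sums determine the matrix; the       *)
(* default value 0 would only be returned if there were no minimum.            *)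
Definition asm_pi n (i : nat) (A : 'M[int]_n) : 'M[int]_n :=
  xget 0 [set B | is_strong_min (row_class i A) B].

Definition asm_piC n (i : nat) (A : 'M[int]_n) : 'M[int]_n :=
  (asm_pi i A^T)^T.

Definition row_partial_sums n (A : 'M[int]_n) : 'M[int]_n :=
  \matrix_(i, j) \sum_(a < n | (a <= i)%N) A a j.

(* The list of rows of the triangle, each of them the list of 1-based column   *)
(* indices of the ones; it is increasing because enum 'I_n is.                 *)
Definition monotone_triangle n (A : 'M[int]_n) : seq (seq nat) :=
  [seq [seq (j : nat).+1 | j : 'I_n <- enum 'I_n & row_partial_sums A i j == 1]
  | i <- enum 'I_n].

Definition replace_succ (i : nat) (s : seq nat) : seq nat :=
  if (i.+1 \in s) && (i \notin s)
  then [seq if x == i.+1 then i else x | x <- s] else s.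

(* Main.v *)
Require Import Defs.
From mathcomp Require Import all_boot all_order all_algebra.
From mathcomp Require Import boolp classical_sets.
From mathcomp Require Import zify.

(** Everything is read off the corner sums, taken with a border of zeros.
    A matrix is an ASM exactly when its bordered corner sum function r moves by
    0 or 1 at each unit step and reaches n at (n, n) ([is_asm_corner]), and any
    such r comes from a matrix ([csum_matrix_of_corner]).

    Fix r outside row i.  The two unit-step conditions linking row i with rows
    i - 1 and i + 1 give r i b <= min (r (i - 1) b + 1) (r (i + 1) b).  Putting
    this upper bound in row i again gives a corner sum function
    ([is_corner_raise]); having the largest corner sums, it is the minimum of
    the strong order, so it is the corner sum function of [asm_pi i A]
    ([asm_piE]).  Transposing gives the same formula in column i for
    [asm_piC i A] ([csum_asm_piC]).

    Column x occurs in row a of the monotone triangle iff r a x - r a (x - 1)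
    equals 1.  Write u, v in {0, 1} for these differences at x = i and
    x = i + 1.  Raising r a i to min (r a (i - 1) + 1) (r a (i + 1)) turns
    (u, v) into (u || v, u && v) and leaves the other columns alone: the only
    change is that (0, 1) becomes (1, 0), that is, i + 1 is replaced by i
    whenever i is absent ([replace_succ_filter]). *)

Set Implicit Arguments.
Unset Strict Implicit.
Unset Printing Implicit Defensive.

Import Order.TTheory GRing.Theory Num.Theory.
Local Open Scope ring_scope.

(** * Bordered corner sums *)

(** Indexing by numbers rather than by ordinals adds the row and column of
    zeros that make unit steps uniform up to the boundary. *)
Definition csum n (A : 'M[int]_n) (a b : nat) : int :=
  \sum_(x < n | (x < a)%N) \sum_(y < n | (y < b)%N) A x y.

Lemma corner_sumE n (A : 'M[int]_n) (i j : 'I_n) :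
  corner_sum A i j = csum A i.+1 j.+1.
Proof. by []. Qed.

Lemma sum_ord_ltS n (F : 'I_n -> int) (i : 'I_n) :
  \sum_(x < n | (x < i.+1)%N) F x = \sum_(x < n | (x < i)%N) F x + F i.
Proof.
rewrite (bigD1 i) ?ltnS //= addrC; congr (_ + _).
by apply: eq_bigl => x; rewrite -val_eqE /=; lia.
Qed.

Lemma csum0l n (A : 'M[int]_n) b : csum A 0 b = 0.
Proof. by rewrite /csum big_pred0. Qed.

Lemma csum_tr n (A : 'M[int]_n) a b : csum A^T a b = csum A b a.
Proof.
rewrite /csum exchange_big; apply: eq_bigr => x _.
by apply: eq_bigr => y _; rewrite mxE.
Qed.

Lemma csum0r n (A : 'M[int]_n) a : csum A a 0 = 0.
Proof. by rewrite -csum_tr csum0l. Qed.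

Lemma csumSl n (A : 'M[int]_n) (i : 'I_n) b :
  csum A i.+1 b = csum A i b + \sum_(y < n | (y < b)%N) A i y.
Proof. exact: (sum_ord_ltS (fun x => \sum_(y < n | (y < b)%N) A x y) i). Qed.

Lemma csumSr n (A : 'M[int]_n) a (j : 'I_n) :
  csum A a j.+1 = csum A a j + \sum_(x < n | (x < a)%N) A x j.
Proof.
rewrite -[LHS]csum_tr csumSl csum_tr; congr (_ + _).
by apply: eq_bigr => x _; rewrite mxE.
Qed.

Lemma csum_total n (A : 'M[int]_n) :
  csum A n n = \sum_(i < n) \sum_(j < n) A i j.
Proof.
rewrite /csum; apply: eq_big => [x|x _]; first by rewrite ltn_ord.
by apply: eq_bigl => y; rewrite ltn_ord.
Qed.

(** Möbius inversion of the corner sums. *)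
Lemma entry_csum n (A : 'M[int]_n) (i j : 'I_n) :
  A i j = (csum A i.+1 j.+1 - csum A i j.+1) - (csum A i.+1 j - csum A i j).
Proof. by rewrite !csumSl (sum_ord_ltS (A i) j); lia. Qed.

Lemma corner_sum_inj n (A B : 'M[int]_n) :
  corner_sum A =2 corner_sum B -> A = B.
Proof.
move=> eqAB; have eqc a b : (a <= n)%N -> (b <= n)%N -> csum A a b = csum B a b.
  case: a b => [|a] [|b]; rewrite ?csum0l ?csum0r // => ha hb.
  exact: (eqAB (Ordinal ha) (Ordinal hb)).
by apply/matrixP => i j; rewrite !entry_csum !eqc // ltnW.
Qed.

(** * Corner sum functions of alternating sign matrices *)

Definition unit_step (x y : int) := (x <= y <= x + 1)%R.

Record is_corner n (r : nat -> nat -> int) : Prop := IsCorner {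
  corner0l : forall b, r 0%N b = 0;
  corner0r : forall a, r a 0%N = 0;
  corner_stepl : forall a b, (a < n)%N -> (b <= n)%N ->
    unit_step (r a b) (r a.+1 b);
  corner_stepr : forall a b, (a <= n)%N -> (b < n)%N ->
    unit_step (r a b) (r a b.+1);
  corner_total : r n n = n%:Z }.

Lemma mem01_unit_step (x d : int) : (d \in [:: 0; 1]) = unit_step x (x + d).
Proof. by rewrite !inE /unit_step; lia. Qed.

(** The partial sums of a row of A are the vertical steps of the corner sums,
    those of a column are the horizontal steps.  The entries, as differences of
    two such steps, lie in {-1, 0, 1}. *)
Lemma is_asm_corner n (A : 'M[int]_n) : is_asm A <-> is_corner n (csum A).
Proof.
split=> [[_ rowA colA totA]|[c0l c0r cl cr ctot]].
  split; rewrite ?csum_total //; try exact: csum0l; try exact: csum0r.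
    move=> a [|b] ha hb; first by rewrite !csum0r.
    by rewrite (csumSl A (Ordinal ha)) -mem01_unit_step
       (rowA (Ordinal ha) (Ordinal hb)).
  move=> [|a] b ha hb; first by rewrite !csum0l.
  by rewrite (csumSr A _ (Ordinal hb)) -mem01_unit_step
     (colA (Ordinal hb) (Ordinal ha)).
split.
- move=> i j; rewrite entry_csum !inE.
  have := cl i j.+1 (ltn_ord i) (ltn_ord j).
  have := cl i j (ltn_ord i) (ltnW (ltn_ord j)).
  by rewrite /unit_step; lia.
- move=> i m; have := cl i m.+1 (ltn_ord i) (ltn_ord m).
  by rewrite csumSl -mem01_unit_step.
- move=> j m; have := cr m.+1 j (ltn_ord m) (ltn_ord j).
  by rewrite csumSr -mem01_unit_step.
- by rewrite -csum_total.
Qed.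

Lemma is_asm_tr n (A : 'M[int]_n) : is_asm A -> is_asm A^T.
Proof.
move=> /is_asm_corner[c0l c0r cl cr ctot]; apply/is_asm_corner.
by split=> *; rewrite !csum_tr; auto.
Qed.

Definition matrix_of_corner n (r : nat -> nat -> int) : 'M[int]_n :=
  \matrix_(x, y) ((r x.+1 y.+1 - r x y.+1) - (r x.+1 y - r x y)).

Lemma csum_matrix_of_corner n r a b : is_corner n r ->
  (a <= n)%N -> (b <= n)%N -> csum (matrix_of_corner n r) a b = r a b.
Proof.
case=> c0l c0r _ _ _; elim: a b => [|a IHa] b; first by rewrite csum0l c0l.
move=> ha; elim: b => [|b IHb] hb; first by rewrite csum0r c0r.
have := entry_csum (matrix_of_corner n r) (Ordinal ha) (Ordinal hb).
rewrite mxE /= IHb ?(ltnW hb) // !IHa ?(ltnW ha) ?(ltnW hb) //.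
by lia.
Qed.

(** * The minimum of a row class *)

Definition raise_row (i : nat) (r : nat -> nat -> int) (a b : nat) : int :=
  if a == i then Num.min (r i.-1 b + 1) (r i.+1 b) else r a b.

(** Vertically, r (i + 1) b - r (i - 1) b is 0, 1 or 2, since it is the sum of
    the two unit steps through the old row; the minimum then lies 0 or 1 above
    row i - 1 and 0 or 1 below row i + 1.  Horizontally, the minimum of two
    functions with unit steps has unit steps. *)
Lemma is_corner_raise n i r : (0 < i < n)%N -> is_corner n r ->
  is_corner n (raise_row i r).
Proof.
case: i => [//|i] /= hi [c0l c0r cl cr ctot]; split; rewrite /raise_row.
- by move=> b; rewrite c0l.
- by move=> a; rewrite !c0r; case: eqP.
- move=> a b ha hb.
  have step1 := cl i b ltac:(lia) hb; have step2 := cl i.+1 b ltac:(lia) hb.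
  rewrite /unit_step in step1 step2; rewrite eqSS.
  case: (a =P i.+1) => [->|_]; first by rewrite ifN /unit_step /=; lia.
  by case: (a =P i) => [->|_]; [rewrite /unit_step /=; lia | exact: cl].
- move=> a b ha hb; case: eqP => [_|_]; last exact: cr.
  have := cr i b ltac:(lia) hb; have := cr i.+2 b ltac:(lia) hb.
  by rewrite /unit_step /=; lia.
- by rewrite ctot; case: eqP => //; lia.
Qed.

Lemma corner_le_raise n i r a b : (0 < i < n)%N -> is_corner n r ->
  (b <= n)%N -> r a b <= raise_row i r a b.
Proof.
case: i => [//|i] /= hi [_ _ cl _ _] hb; rewrite /raise_row.
case: eqP => [->|] //.
have := cl i b ltac:(lia) hb; have := cl i.+1 b ltac:(lia) hb.
by rewrite /unit_step /=; lia.
Qed.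

Lemma row_class_csum n i (A B : 'M[int]_n) a b : row_class i A B ->
  (a <= n)%N -> (b <= n)%N -> a != i -> csum B a b = csum A a b.
Proof.
case=> _ eqAB; case: a b => [|a] [|b]; rewrite ?csum0l ?csum0r // => ha hb.
exact: (eqAB (Ordinal ha) (Ordinal hb)).
Qed.

Lemma strong_min_raise n i (A : 'M[int]_n) : (0 < i < n)%N -> is_asm A ->
  is_strong_min (row_class i A) (matrix_of_corner n (raise_row i (csum A))).
Proof.
move=> hi /is_asm_corner cA; have cR := is_corner_raise hi cA.
have csR a b := csum_matrix_of_corner (a := a) (b := b) cR.
split; first split.
- apply/is_asm_corner; split=> *; rewrite ?csum0l ?csum0r ?csR //; try lia;
    [exact: (corner_stepl cR) | exact: (corner_stepr cR)
    | exact: corner_total cR].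
- move=> a b /negPf ai.
  by rewrite !corner_sumE csR // /raise_row ai.
- move=> B clB a b; have [/is_asm_corner cB _] := clB.
  rewrite !corner_sumE csR //.
  (* The raised row only depends on the rows that A and B share. *)
  suff -> : raise_row i (csum A) a.+1 b.+1 = raise_row i (csum B) a.+1 b.+1.
    exact: (corner_le_raise _ hi cB).
  rewrite /raise_row; case: eqP => [_|/eqP ai].
    by rewrite !(row_class_csum clB) //; lia.
  by rewrite (row_class_csum clB).
Qed.

Lemma strong_min_unique n (S : set 'M[int]_n) (B C : 'M[int]_n) :
  is_strong_min S B -> is_strong_min S C -> B = C.
Proof.
move=> [SB minB] [SC minC]; apply: corner_sum_inj => a b.
by apply/le_anti; rewrite (minB _ SC) (minC _ SB).
Qed.

Lemma asm_piE n i (A : 'M[int]_n) : (0 < i < n)%N -> is_asm A ->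
  asm_pi i A = matrix_of_corner n (raise_row i (csum A)).
Proof.
move=> hi hA; have minR := strong_min_raise hi hA.
exact: strong_min_unique (xgetI 0 minR) minR.
Qed.

Lemma csum_asm_piC n i (A : 'M[int]_n) a b : (0 < i < n)%N -> is_asm A ->
  (a <= n)%N -> (b <= n)%N -> csum (asm_piC i A) a b =
  if b == i then Num.min (csum A a i.-1 + 1) (csum A a i.+1) else csum A a b.
Proof.
move=> hi hA ha hb; have hAt := is_asm_tr hA.
have cR := is_corner_raise hi ((is_asm_corner _).1 hAt).
by rewrite csum_tr asm_piE // (csum_matrix_of_corner cR) // /raise_row !csum_tr.
Qed.

(** * Rows of the monotone triangle *)

Definition triangle_row n (A : 'M[int]_n) (a : nat) : seq nat :=
  [seq x <- iota 1 n | csum A a x - csum A a x.-1 == 1].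

Lemma monotone_triangleE n (A : 'M[int]_n) :
  monotone_triangle A = [seq triangle_row A a.+1 | a : 'I_n <- enum 'I_n].
Proof.
apply: eq_map => a; rewrite /triangle_row -[1%N]addn0 iotaDl filter_map.
rewrite -val_enum_ord filter_map -map_comp; congr map.
by apply: eq_filter => j; rewrite /= mxE csumSr addrC addKr.
Qed.

(** On a set of numbers given by its characteristic function, replacing i + 1
    by i when i is absent puts the values at i and i + 1 in decreasing order. *)
Lemma replace_succ_filter n i (g g' : pred nat) : (0 < i < n)%N ->
    g' i = g i || g i.+1 -> g' i.+1 = g i && g i.+1 ->
    (forall x, (0 < x <= n)%N -> x != i -> x != i.+1 -> g' x = g x) ->
  replace_succ i [seq x <- iota 1 n | g x] = [seq x <- iota 1 n | g' x].
Proof.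
move=> hi g'i g'i1 g'x.
rewrite /replace_succ !mem_filter !mem_iota.
have -> : (0 < i.+1 < 1 + n)%N by lia.
have -> : (0 < i < 1 + n)%N by lia.
rewrite !andbT; case: ifP => [/andP[gi1 gi]|gii].
  have -> : n = (i.-1 + (2 + (n - i.+1)))%N by lia.
  rewrite 2!iotaD; have -> : (1 + i.-1 = i)%N by lia.
  rewrite !filter_cat !map_cat /= g'i g'i1 gi1 (negPf gi) /= eqxx.
  have fixed s : {in s, forall x, [&& 0 < x <= n, x != i & x != i.+1]%N} ->
      [seq if x == i.+1 then i else x | x <- s & g x] = [seq x <- s | g' x].
    move=> hs; rewrite (@eq_in_filter _ g' g) => [|x /hs /and3P[]];
      last exact: g'x.
    rewrite -[RHS]map_id; apply/eq_in_map => x.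
    by rewrite mem_filter => /andP[_ /hs /and3P[_ _ /negPf->]].
  by congr (_ ++ _ :: _); apply: fixed => x; rewrite mem_iota; lia.
apply: eq_in_filter => x; rewrite mem_iota => hx.
have [->|xi] := eqVneq x i.
  by rewrite g'i; case: (g i) gii; case: (g i.+1).
have [->|xi1] := eqVneq x i.+1.
  by rewrite g'i1; case: (g i) gii; case: (g i.+1).
by rewrite g'x.
Qed.

Theorem proposition4p10 (n : nat) (A : 'M[int]_n) (i : nat)
    (hA : is_asm A) (hi : (0 < i < n)%N) :
  [seq replace_succ i s | s <- monotone_triangle A]
    = monotone_triangle (asm_piC i A).
Proof.
rewrite !monotone_triangleE -map_comp; apply: eq_map => a /=.
have cs b := csum_asm_piC (a := a.+1) (b := b) hi hA (ltn_ord a).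
have [_ _ _ cr _] := (is_asm_corner A).1 hA.
have step1 := cr a.+1 i.-1 (ltn_ord a) ltac:(lia).
have step2 := cr a.+1 i (ltn_ord a) ltac:(lia).
rewrite /unit_step prednK in step1 step2; last lia.
apply: replace_succ_filter => //= [||x hx xi xi1]; rewrite !cs; try lia.
- by rewrite eqxx ifN; lia.
- by rewrite eqxx ifN; lia.
- by rewrite !ifN //; lia.
Qed.
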